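(* Let $A\in\mathbb R^{m\times n}$ and $\beta\in\mathbb R^n$ be non-zero and such that the polyhedra $P$ and $Q'$ (defined in the context) are non-degenerate. Let $\Gamma=\{(A,-A+\alpha\beta^T):\alpha\in\mathbb R^m\}$ and let $$E_\Gamma=\{(\alpha,x,y)\in\mathbb R^m\times\Delta_1\times\Delta_2:(x,y)\text{ is a Nash equilibrium of }(A,-A+\alpha\beta^T)\}.$$ Then $E_\Gamma$ is homeomorphic to $\Gamma$ (where $\Gamma\cong\mathbb R^m$ via the parameter $\alpha$).
   Context: Let $S_1=\{1,\dots,m\}$, $S_2=\{1,\dots,n\}$, and let $\Delta_1\subset\mathbb R^m$, $\Delta_2\subset\mathbb R^n$ be the standard probability simplices. For a matrix $M$, $M_i$ is its $i$-th row and $M^j$ its $j$-th column. A Nash equilibrium of a bimatrix game $(A,B)$ is $(x,y)\in\Delta_1\times\Delta_2$ with $x^TAy\ge x'^TAy$ for all $x'\in\Delta_1$ and $x^TBy\ge x^TBy'$ for all $y'\in\Delta_2$. $P=\{(y,\pi_1)\in\mathbb R^{n+1}: A_iy-\pi_1\le0\ (i\in S_1);\ y_j\ge0\ (j\in S_2);\ \sum_j y_j=1\}$ (of dimension $n$). $Q'=\{(x,\lambda,\pi_2)\in\mathbb R^{m+2}: x_i\ge0\ (i\in S_1);\ -x^TA^j+\beta_j\lambda-\pi_2\le0\ (j\in S_2);\ \sum_i x_i=1\}$ (of dimension $m+1$). Non-degeneracy: every point in the relative interior of a $d$-dimensional face of $P$ (resp. $Q'$) has exactly $n-d$ (resp.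 $m+1-d$) of the listed inequalities tight. All sets carry the Euclidean subspace topology. *)

(* Defs.v *)
From HB Require Import structures.
From mathcomp Require Import all_boot all_order all_algebra.
From mathcomp Require Import all_classical all_reals all_analysis.

Set Implicit Arguments.
Unset Strict Implicit.
Unset Printing Implicit Defensive.

Import Order.TTheory GRing.Theory Num.Theory.
Import numFieldNormedType.Exports.

Local Open Scope classical_set_scope.
Local Open Scope ring_scope.

(* [S] and [T] carry the subspace topology; the values of [f] outside [S] and
   of its inverse [g] outside [T] are irrelevant. *)
Definition homeomorphism (X Y : topologicalType) (S : set X) (T : set Y)
    (f : X -> Y) : Prop :=
  [/\ set_bij S T f,
      {within S, continuous f} &
      exists2 g : Y -> X, {in S, cancel f g} & {within T, continuous g}].

Definition homeomorphic (X Y : topologicalType) (S : set X) (T : set Y) : Prop :=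
  exists f : X -> Y, homeomorphism S T f.

Definition simplex (R : realType) (n : nat) : set 'cV[R]_n :=
  [set x | (forall i, 0 <= x i 0) /\ \sum_i x i 0 = 1].

Definition payoff (R : realType) (m n : nat) (M : 'M[R]_(m, n))
    (x : 'cV[R]_m) (y : 'cV[R]_n) : R :=
  (x^T *m M *m y) 0 0.

Definition nash (R : realType) (m n : nat) (A B : 'M[R]_(m, n))
    (x : 'cV[R]_m) (y : 'cV[R]_n) : Prop :=
  [/\ simplex x, simplex y,
      forall x', simplex x' -> payoff A x' y <= payoff A x y &
      forall y', simplex y' -> payoff B x y' <= payoff B x y].

(* Taking c = 0 makes X itself a face of X; the empty set may also be a face. *)
Definition face (R : realType) (N : nat) (X F : set 'cV[R]_N) : Prop :=
  exists (c : 'cV[R]_N) (q : R),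
    (forall z, X z -> (c^T *m z) 0 0 <= q) /\
    F = [set z | X z /\ (c^T *m z) 0 0 = q].

Definition aff_hull (R : realType) (N : nat) (F : set 'cV[R]_N) : set 'cV[R]_N :=
  [set z | exists (k : nat) (p : 'I_k -> 'cV[R]_N) (c : 'I_k -> R),
    [/\ forall i, F (p i), \sum_i c i = 1 & z = \sum_i c i *: p i]].

(* The empty set has no dimension in this sense. *)
Definition has_dim (R : realType) (N : nat) (F : set 'cV[R]_N) (d : nat) : Prop :=
  exists (p : 'cV[R]_N) (V : {vspace 'cV[R]_N}),
    \dim V = d /\ aff_hull F = [set z | z - p \in V].

Definition relint (R : realType) (N : nat) (F : set 'cV[R]_N) : set 'cV[R]_N :=
  [set z | F z /\ \forall w \near z, aff_hull F w -> F w].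

(* The inequalities are listed as [h i z <= 0] for [i : I], with repetitions
   counted separately; [D] is the dimension of the polyhedron [X], and there
   must be D - d tight inequalities. *)
Definition nondegenerate_ineqs (R : realType) (N : nat) (I : finType)
    (h : I -> 'cV[R]_N -> R) (X : set 'cV[R]_N) (D : nat) : Prop :=
  forall (F : set 'cV[R]_N) (d : nat) (z : 'cV[R]_N),
    face X F -> has_dim F d -> relint F z ->
    (#|[pred i | h i z == 0%R]| + d = D)%N.

(* A point of R^(n+1) is z = (y, pi_1). *)
Definition ineqP (R : realType) (m n : nat) (A : 'M[R]_(m, n))
    (k : 'I_m + 'I_n) (z : 'cV[R]_(n + 1)) : R :=
  let y := usubmx z in
  let pi1 := dsubmx z 0 0 in
  match k with
  | inl i => (row i A *m y) 0 0 - pi1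
  | inr j => - y j 0
  end.

Definition polyhedronP (R : realType) (m n : nat) (A : 'M[R]_(m, n)) :
    set 'cV[R]_(n + 1) :=
  [set z | (forall k, ineqP A k z <= 0) /\ \sum_j usubmx z j 0 = 1].

(* A point of R^(m+2) is z = (x, lambda, pi_2). *)
Definition ineqQ' (R : realType) (m n : nat) (A : 'M[R]_(m, n))
    (beta : 'cV[R]_n) (k : 'I_m + 'I_n) (z : 'cV[R]_(m + 2)) : R :=
  let x := usubmx z in
  let lambda := dsubmx z ord0 0 in
  let pi2 := dsubmx z ord_max 0 in
  match k with
  | inl i => - x i 0
  | inr j => - (x^T *m col j A) 0 0 + beta j 0 * lambda - pi2
  end.

Definition polyhedronQ' (R : realType) (m n : nat) (A : 'M[R]_(m, n))
    (beta : 'cV[R]_n) : set 'cV[R]_(m + 2) :=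
  [set z | (forall k, ineqQ' A beta k z <= 0) /\ \sum_i usubmx z i 0 = 1].

Definition game (R : realType) (m n : nat) (A : 'M[R]_(m, n))
    (beta : 'cV[R]_n) (alpha : 'cV[R]_m) : 'M[R]_(m, n) * 'M[R]_(m, n) :=
  (A, - A + alpha *m beta^T).

Definition Gamma (R : realType) (m n : nat) (A : 'M[R]_(m, n))
    (beta : 'cV[R]_n) : set ('M[R]_(m, n) * 'M[R]_(m, n)) :=
  range (game A beta).

(* A point is p = (alpha, x, y), i.e. ((alpha, x), y). *)
Definition E_Gamma (R : realType) (m n : nat) (A : 'M[R]_(m, n))
    (beta : 'cV[R]_n) : set ('cV[R]_m * 'cV[R]_m * 'cV[R]_n) :=
  [set p | nash A (- A + p.1.1 *m beta^T) p.1.2 p.2].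

(* Main.v *)
Require Import Defs.
From mathcomp Require Import all_boot all_order all_algebra.
From mathcomp Require Import all_classical all_reals all_analysis.
From mathcomp Require Import ring lra zify.
Import numFieldNormedType.Exports.
Import Order.TTheory GRing.Theory Num.Theory.
Set Implicit Arguments.
Unset Strict Implicit.
Unset Printing Implicit Defensive.
Local Open Scope classical_set_scope.
Local Open Scope ring_scope.

(* Put l = alpha^T x. Then (x, y) is an equilibrium of (A, -A + alpha beta^T)
   iff it is one of (A, -A + l 1 beta^T), which is strategically equivalent to
   the zero-sum game with matrix A - l 1 beta^T. Hence beta^T y is
   nondecreasing in l, and s = l + beta^T y determines both l and beta^T y.
   Non-degeneracy makes the gradients of the tight constraints linearly
   independent; x and y are Lagrange multipliers for a point of P and of Q',
   so they are determined by s too. Conversely each s is attained: minimise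
   pi_1 - s beta^T y + (beta^T y)^2 / 2 over P and read x off the multipliers.
   Compactness of the simplices makes s |-> (x, y) continuous. Finally s
   together with alpha modulo constant vectors coordinatises E_Gamma. *)

(** * Tight constraints of a non-degenerate polyhedron *)

Definition rowval (R : realType) (N : nat) (a : 'rV[R]_N) (z : 'cV[R]_N) : R :=
  (a *m z) 0 0.

(** Both P and Q' have this shape: every listed inequality is homogeneous, and the only
    inhomogeneous constraint is that the entries of the strategy sum to 1. *)
Definition cone_slice (R : realType) (N : nat) (I : finType)
    (a : I -> 'rV[R]_N) (e : 'rV[R]_N) : set 'cV[R]_N :=
  [set z | (forall k, rowval (a k) z <= 0) /\ rowval e z = 1].

Lemma rowvalE (R : realType) (N : nat) (a : 'rV[R]_N) (z : 'cV[R]_N) :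
  rowval a z = \sum_i a 0 i * z i 0.
Proof. by rewrite /rowval mxE. Qed.

Lemma rowvalDZ (R : realType) (N : nat) (a : 'rV[R]_N) (z w : 'cV[R]_N) (t : R) :
  rowval a (z + t *: w) = rowval a z + t * rowval a w.
Proof. by rewrite /rowval mulmxDr -scalemxAr !mxE. Qed.

Lemma rowvalB (R : realType) (N : nat) (a : 'rV[R]_N) (z w : 'cV[R]_N) :
  rowval a (z - w) = rowval a z - rowval a w.
Proof. by rewrite -scaleN1r rowvalDZ mulN1r. Qed.

Lemma rowvalN (R : realType) (N : nat) (a : 'rV[R]_N) (z : 'cV[R]_N) :
  rowval a (- z) = - rowval a z.
Proof. by rewrite /rowval mulmxN mxE. Qed.

Lemma rowval_sum (R : realType) (N : nat) (I : Type) (r : seq I) (P : pred I)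
    (a : 'rV[R]_N) (c : I -> R) (w : I -> 'cV[R]_N) :
  rowval a (\sum_(i <- r | P i) c i *: w i) =
  \sum_(i <- r | P i) c i * rowval a (w i).
Proof.
rewrite /rowval mulmx_sumr summxE; apply: eq_bigr => i _.
by rewrite -scalemxAr mxE.
Qed.

Lemma sum_rowval (R : realType) (N : nat) (I : Type) (r : seq I) (P : pred I)
    (a : I -> 'rV[R]_N) (z : 'cV[R]_N) :
  rowval (\sum_(i <- r | P i) a i) z = \sum_(i <- r | P i) rowval (a i) z.
Proof. by rewrite /rowval mulmx_suml summxE. Qed.

Lemma sum_continuous (R : realType) (T : topologicalType) (I : finType)
    (f : I -> T -> R) :
  (forall i, continuous (f i)) -> continuous (fun p => \sum_i f i p).
Proof.
move=> cf p; apply: (@cvg_big R _ +%R 0) => [x|i _]; last exact: cf.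
by apply: cvgD; [exact: cvg_fst | exact: cvg_snd].
Qed.

Lemma add_continuous_fun (R : realType) (T : topologicalType) (f g : T -> R) :
  continuous f -> continuous g -> continuous (fun p => f p + g p).
Proof. by move=> cf cg p; apply: cvgD; [exact: cf | exact: cg]. Qed.

Lemma opp_continuous_fun (R : realType) (T : topologicalType) (f : T -> R) :
  continuous f -> continuous (fun p => - f p).
Proof. by move=> cf p; apply: cvgN; exact: cf. Qed.

Lemma mul_continuous_fun (R : realType) (T : topologicalType) (f g : T -> R) :
  continuous f -> continuous g -> continuous (fun p => f p * g p).
Proof. by move=> cf cg p; apply: cvgM; [exact: cf | exact: cg]. Qed.

Lemma rowval_continuous (R : realType) (N : nat) (a : 'rV[R]_N) :
  continuous (rowval a).
Proof.
have -> : rowval a = fun z => \sum_i a 0 i * z i 0.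
  by apply/funext => z; exact: rowvalE.
apply: sum_continuous => i.
apply: mul_continuous_fun; first exact: cst_continuous.
exact: coord_continuous.
Qed.

Lemma mx_continuous (R : realType) (m n : nat) (T : topologicalType)
    (f : T -> 'M[R]_(m, n)) :
  (forall i j, continuous (fun p => f p i j)) -> continuous f.
Proof.
move=> cf p U [P nP sPU].
have : \forall q \near p, forall i j, P i j (f q i j).
  by apply: filter_forall => i; apply: filter_forall => j; exact: cf (nP i j).
by apply: filterS => q Pq; apply: sPU.
Qed.

Lemma cV_box_compact (R : realType) (N : nat) (K : R) :
  compact [set z : 'cV[R]_N | forall i, `|z i 0| <= K].
Proof.
have -> : [set z : 'cV[R]_N | forall i, `|z i 0| <= K] =
    trmx @` [set v : 'rV[R]_N | forall i, `[- K, K]%classic (v ord0 i)].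
  apply/seteqP; split => [z zK|_ [v vK <-] i].
    exists z^T; last by rewrite trmxK.
    by move=> i; rewrite /= mxE in_itv /= -ler_norml.
  by have := vK i; rewrite /= mxE in_itv /= -ler_norml.
have ct : continuous (trmx : 'rV[R]_N -> 'cV[R]_N).
  apply: mx_continuous => i j; under eq_fun do rewrite mxE.
  exact: (@coord_continuous R 1 N).
have cK : compact [set v : 'rV[R]_N | forall i, `[- K, K]%classic (v ord0 i)].
  have cI := @segment_compact R (- K) K.
  exact: (@rV_compact R N (fun=> `[- K, K]%classic)) (fun=> cI).
exact: continuous_compact (continuous_subspaceT ct) cK.
Qed.

Lemma continuous_lt0_near (R : realType) (T : topologicalType) (I : finType)
    (f : I -> T -> R) (p : T) :
  (forall k, continuous (f k)) ->
  \forall q \near p, forall k, f k p < 0 -> f k q < 0.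
Proof.
move=> cf; apply: filter_forall => k.
have [pk|pk] := ltP (f k p) 0; last by apply: nearW => q.
have : nbhs p (f k @^-1` [set x | x < 0]).
  by apply: cf; exact: open_nbhs_nbhs (conj (@open_lt R 0) pk).
by apply: filterS.
Qed.

Lemma slack_near (R : realType) (N : nat) (I : finType) (a : I -> 'rV[R]_N)
    (z : 'cV[R]_N) :
  \forall w \near z, forall k, rowval (a k) z < 0 -> rowval (a k) w < 0.
Proof. by apply: continuous_lt0_near => k; exact: rowval_continuous. Qed.

(** Along [w] the tight constraints do not increase, and the finitely many slack ones stay slack for
    a short time. *)
Lemma feasible_direction (R : realType) (N : nat) (I : finType)
    (a : I -> 'rV[R]_N) (e : 'rV[R]_N) (z w : 'cV[R]_N) :
  cone_slice a e z -> rowval e w = 0 ->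
  (forall k, rowval (a k) z = 0 -> rowval (a k) w <= 0) ->
  exists2 eps, 0 < eps &
    forall t, 0 <= t <= eps -> cone_slice a e (z + t *: w).
Proof.
move=> [az ez] ew aw.
have ct : z + t *: w @[t --> (0 : R)] --> z.
  rewrite -[X in _ --> X]addr0 -(scale0r w).
  by apply: cvgD; [exact: cvg_cst | apply: cvgZr_tmp; exact: cvg_id].
have /nbhs_ballP[d /= d0 dP] := ct _ (slack_near a z).
exists (d / 2); first by rewrite divr_gt0.
move=> t /andP[t0 td]; split => [k|]; last by rewrite rowvalDZ ew mulr0 addr0.
have := az k; rewrite le_eqVlt => /orP[/eqP zk|zk].
  by rewrite rowvalDZ zk add0r mulr_ge0_le0 // aw.
apply/ltW/(dP t _ k zk); rewrite /ball /= sub0r normrN ger0_norm //.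
by rewrite (le_lt_trans td) // ltr_pdivrMr // ltr_pMr // ltr1n.
Qed.

(** Take the face [F] of points where everything tight at [z] stays tight. Its affine hull is [z]
    plus the kernel of the map given by the tight gradients and [e], and [z] is in its relative
    interior. Non-degeneracy then says that this kernel has dimension [D] minus the number of tight
    constraints, so by rank-nullity in dimension [D.+1] the map is onto. Equivalently, the tight
    gradients and [e] are linearly independent. *)
Lemma tight_surjective (R : realType) (N D : nat) (I : finType)
    (a : I -> 'rV[R]_N) (e : 'rV[R]_N) (z : 'cV[R]_N) (t : I -> R) :
  N = D.+1 ->
  nondegenerate_ineqs (fun k => rowval (a k)) (cone_slice a e) D ->
  cone_slice a e z ->
  exists2 w, rowval e w = 0 &
    forall k, rowval (a k) z = 0 -> rowval (a k) w = t k.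
Proof.
move=> ND nd Xz; have [az ez] := Xz.
pose T := [pred k | rowval (a k) z == 0].
pose F := [set w | cone_slice a e w /\ forall k, T k -> rowval (a k) w = 0].
pose M := col_mx (\matrix_(i < #|T|) a (enum_val i)) e.
pose f : 'Hom('cV[R]_N, 'cV[R]_(#|T| + 1)) := linfun (mulmx M).
have Mu w i : (M *m w) (lshift 1 i) 0 = rowval (a (enum_val i)) w.
  rewrite mul_col_mx col_mxEu /rowval.
  by rewrite -[a _](rowK (fun i => a (enum_val i))) -row_mul [RHS]mxE.
have Md w i : (M *m w) (rshift #|T| i) 0 = rowval e w.
  by rewrite mul_col_mx col_mxEd /rowval ord1.
have enumT k : T k -> exists i : 'I_#|T|, enum_val i = k.
  move=> Tk; have Tk' : k \in T by [].
  by exists (enum_rank_in Tk' k); rewrite enum_rankK_in.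
have kerP w : w \in lker f <->
    rowval e w = 0 /\ forall k, T k -> rowval (a k) w = 0.
  rewrite memv_ker lfunE /=; split => [/eqP Mw|[ew aw]].
    split; first by rewrite -(Md w 0) Mw mxE.
    by move=> k /enumT[i <-]; rewrite -Mu Mw mxE.
  apply/eqP/colP => i; rewrite [RHS]mxE; case: (split_ordP i) => j ->.
    by rewrite Mu aw //; exact: (enum_valP j).
  by rewrite Md.
have faceF : face (cone_slice a e) F.
  (* The sum of the tight gradients is at most 0 on the slice, and it vanishes only where each of
     its summands does. *)
  exists (\sum_(k | T k) a k)^T, 0; split=> [w [aw _]|].
    by rewrite trmxK -/(rowval _ _) sum_rowval; apply: sumr_le0.
  apply/seteqP; split => w [Xw aw]; split => //=.
    by rewrite trmxK -/(rowval _ _) sum_rowval big1.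
  move: aw; rewrite trmxK -/(rowval _ _) sum_rowval => /eqP.
  rewrite -oppr_eq0 -sumrN psumr_eq0 => [/allP s0 k Tk|k _].
    have /implyP/(_ Tk) := s0 k (mem_index_enum _).
    by rewrite oppr_eq0 => /eqP.
  by rewrite oppr_ge0; case: Xw.
have Fz : F z by split => // k /eqP.
have subF w : aff_hull F w -> w - z \in lker f.
  move=> [k [p [c [Fp c1 ->]]]]; apply/kerP; split => [|l Tl].
    rewrite rowvalB rowval_sum (eq_bigr c) ?c1 ?ez ?subrr // => i _.
    by have [[_ ->] _] := Fp i; rewrite mulr1.
  rewrite rowvalB rowval_sum big1 => [|i _].
    by have /eqP -> := Tl; rewrite subrr.
  by have [_ ->] := Fp i; rewrite ?mulr0.
have dimF : has_dim F (\dim (lker f)).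
  exists z, (lker f); split => //; apply/seteqP; split => w /=; first exact: subF.
  move=> /kerP[ew aw].
  have [||eps e0 /(_ eps)] := @feasible_direction _ _ _ a e z (w - z) Xz => //.
    by move=> k /eqP /aw ->.
  rewrite lexx ltW // => /(_ isT) Xp.
  (* Feasibility is known only for a short step from [z] towards [w]; [w] itself is the affine
     combination of [z] and that nearby point with weights [1 - eps^-1] and [eps^-1]. *)
  exists 2, (fun i => if i == 0 then z else z + eps *: (w - z)),
    (fun i => if i == 0 then 1 - eps^-1 else eps^-1); split.
  - move=> i; case: ifP => // _; split => // k Tk.
    by rewrite rowvalDZ aw // mulr0 addr0; apply/eqP.
  - by rewrite big_ord_recl big_ord1 /= subrK.
  - rewrite big_ord_recl big_ord1 /= scalerDr scalerA mulVf ?gt_eqF // scale1r.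
    by rewrite addrA -scalerDl subrK scale1r subrKC.
have relF : relint F z.
  (* Near [z] only the tight constraints could fail, and on the affine hull of [F] they remain
     equalities. *)
  split=> //; apply: filterS (slack_near a z) => w sw /subF /kerP[ew aw].
  have tw k : T k -> rowval (a k) w = 0.
    by move=> Tk; have := aw k Tk; rewrite rowvalB (eqP Tk) subr0.
  split => //; split => [k|].
    have := az k; rewrite le_eqVlt => /orP[/tw -> //|/sw /ltW //].
  by move: ew; rewrite rowvalB ez => /eqP; rewrite subr_eq0 => /eqP.
have := nd F _ z faceF dimF relF; rewrite -/T => dimT.
have limf : limg f = fullv.
  apply/eqP; rewrite eqEdim subvf /=.
  have dimcV k : dim 'cV[R]_k = k by rewrite dim_matrix; exact: muln1.
  rewrite dimvf dimcV; have := limg_ker_dim f fullv.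
  rewrite capfv dimvf dimcV => dimL.
  move: dimL dimT; rewrite [X in _ = X -> _]ND.
  move: (\dim (lker f)) (\dim (limg f)) => x y; lia.
pose u : 'cV[R]_(#|T| + 1) := col_mx (\col_i t (enum_val i)) 0.
have /memv_imgP[w _] : u \in limg f by rewrite limf memvf.
rewrite lfunE /= => uw; exists w; first by rewrite -(Md w 0) -uw col_mxEd mxE.
by move=> k /eqP/enumT[i <-]; rewrite -Mu -uw col_mxEu mxE.
Qed.

(** Multipliers of slack constraints vanish. For a tight [k], [tight_surjective] gives a direction
    on which the gradient of [k] is 1 and every other tight gradient is 0; testing on it reads off
    [mu k]. *)
Lemma multipliers_unique (R : realType) (N D : nat) (I : finType)
    (a : I -> 'rV[R]_N) (e : 'rV[R]_N) (z : 'cV[R]_N) (mu mu' : I -> R) :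
  N = D.+1 ->
  nondegenerate_ineqs (fun k => rowval (a k)) (cone_slice a e) D ->
  cone_slice a e z ->
  (forall k, mu k * rowval (a k) z = 0) ->
  (forall k, mu' k * rowval (a k) z = 0) ->
  (forall w, rowval e w = 0 ->
    \sum_k mu k * rowval (a k) w = \sum_k mu' k * rowval (a k) w) ->
  mu =1 mu'.
Proof.
move=> ND nd Xz smu smu' eqmu k.
have supp (nu : I -> R) : (forall l, nu l * rowval (a l) z = 0) ->
    forall l, rowval (a l) z != 0 -> nu l = 0.
  move=> snu l zl; have /eqP := snu l.
  by rewrite mulf_eq0 (negbTE zl) orbF => /eqP.
have [tk|ntk] := eqVneq (rowval (a k) z) 0; last by rewrite !supp.
have [w ew aw] := tight_surjective (fun l => (l == k)%:R) ND nd Xz.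
have pick (nu : I -> R) : (forall l, nu l * rowval (a l) z = 0) ->
    \sum_l nu l * rowval (a l) w = nu k.
  move=> snu; rewrite (bigD1 k) //= aw // eqxx mulr1 big1 ?addr0 // => l lk.
  have [tl|ntl] := eqVneq (rowval (a l) z) 0; last by rewrite supp ?mul0r.
  by rewrite aw // (negbTE lk) mulr0.
by rewrite -pick // eqmu // pick.
Qed.

(** Linear independence of the tight gradients replaces Farkas' lemma. There are directions [d k]
    dual, up to sign, to the tight gradients; each is feasible, so [rowval c (d k)] is non-negative
    and serves as the multiplier. *)
Lemma multipliers_exist (R : realType) (N D : nat) (I : finType)
    (a : I -> 'rV[R]_N) (e c : 'rV[R]_N) (z : 'cV[R]_N) :
  N = D.+1 ->
  nondegenerate_ineqs (fun k => rowval (a k)) (cone_slice a e) D ->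
  cone_slice a e z ->
  (forall w, rowval e w = 0 ->
    (forall k, rowval (a k) z = 0 -> rowval (a k) w <= 0) -> 0 <= rowval c w) ->
  exists mu : I -> R, exists kappa : R,
    [/\ forall k, 0 <= mu k, forall k, mu k * rowval (a k) z = 0 &
      forall w, rowval c w =
        kappa * rowval e w - \sum_k mu k * rowval (a k) w].
Proof.
move=> ND nd Xz cmin; have [_ ez] := Xz.
have /choice[d dP] : forall k, exists w, rowval e w = 0 /\
    forall l, rowval (a l) z = 0 -> rowval (a l) w = - (l == k)%:R.
  move=> k.
  have [w ew aw] := tight_surjective (fun l => - (l == k)%:R) ND nd Xz.
  by exists w.
pose T k := rowval (a k) z == 0.
pose mu k := if T k then rowval c (d k) else 0.
exists mu, (rowval c z); split=> [k|k|w].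
- rewrite /mu; case: ifP => // _; have [ed ad] := dP k.
  by apply: cmin => // l /ad ->; rewrite oppr_le0 ler0n.
- by rewrite /mu /T; case: eqP => [->|_]; rewrite ?mulr0 ?mul0r.
(* [w0] corrects [w] so that [e] and all tight gradients vanish on it. Then [w0] and its opposite
   are both feasible directions, so [c] vanishes on [w0]; expanding this gives the multiplier
   identity with [kappa = rowval c z]. *)
pose w0 := \sum_(k | T k) rowval (a k) w *: d k + 1 *: w + (- rowval e w) *: z.
have valw0 b : rowval b w0 = \sum_(k | T k) rowval (a k) w * rowval b (d k)
    + rowval b w - rowval e w * rowval b z.
  by rewrite /w0 !rowvalDZ rowval_sum mul1r mulNr.
have ew0 : rowval e w0 = 0.
  rewrite valw0 ez mulr1 addrK big1 // => k _.
  by have [-> _] := dP k; rewrite mulr0.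
have aw0 l : rowval (a l) z = 0 -> rowval (a l) w0 = 0.
  move=> zl; rewrite valw0 zl mulr0 subr0 (bigD1 l) /=; last by rewrite /T zl.
  have [_ ->] := dP l => //; rewrite eqxx big1 => [|k /andP[_ kl]].
    by rewrite addr0 mulrN mulr1 addNr.
  by have [_ ->] := dP k => //; rewrite eq_sym (negbTE kl) oppr0 mulr0.
have : rowval c w0 = 0.
  apply/eqP; rewrite eq_le cmin ?andbT // => [|k /aw0 -> //].
  rewrite -oppr_ge0 -rowvalN cmin // => [|k /aw0 aw].
    by rewrite rowvalN ew0 oppr0.
  by rewrite rowvalN aw oppr0.
rewrite valw0 => /eqP; rewrite subr_eq0 => /eqP c0.
rewrite mulrC -c0 addrAC.
rewrite [X in _ = X - _ + _](_ : _ = \sum_k mu k * rowval (a k) w).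
  by rewrite subrr add0r.
rewrite big_mkcond; apply: eq_bigr => k _; rewrite /mu; case: ifP => _.
  by rewrite mulrC.
by rewrite mul0r.
Qed.

(** * The constraints of P and Q' as linear forms *)

Definition gradP (R : realType) (m n : nat) (A : 'M[R]_(m, n))
    (k : 'I_m + 'I_n) : 'rV[R]_(n + 1) :=
  match k with
  | inl i => row_mx (row i A) (const_mx (-1))
  | inr j => row_mx (- delta_mx 0 j) 0
  end.

Definition gradQ' (R : realType) (m n : nat) (A : 'M[R]_(m, n))
    (beta : 'cV[R]_n) (k : 'I_m + 'I_n) : 'rV[R]_(m + 2) :=
  match k with
  | inl i => row_mx (- delta_mx 0 i) 0
  | inr j => row_mx (- (col j A)^T)
      (\row_l (if l == ord0 then beta j 0 else -1))
  end.

Arguments gradP : simpl never.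
Arguments gradQ' : simpl never.

Definition mass_row (R : realType) (m p : nat) : 'rV[R]_(m + p) :=
  row_mx (const_mx 1) 0.

Lemma rowval_row_mx (R : realType) (m p : nat) (u : 'rV[R]_m) (v : 'rV[R]_p)
    (z : 'cV[R]_(m + p)) :
  rowval (row_mx u v) z = rowval u (usubmx z) + rowval v (dsubmx z).
Proof. by rewrite /rowval -[z in LHS]vsubmxK mul_row_col mxE. Qed.

Lemma rowval_mass (R : realType) (m p : nat) (z : 'cV[R]_(m + p)) :
  rowval (mass_row R m p) z = \sum_i usubmx z i 0.
Proof.
rewrite rowval_row_mx [X in _ + X]rowvalE big1 ?addr0 => [|i _].
  by rewrite rowvalE; apply: eq_bigr => i _; rewrite !mxE mul1r.
by rewrite mxE mul0r.
Qed.

Lemma rowval_delta (R : realType) (m p : nat) (j : 'I_m) (z : 'cV[R]_(m + p)) :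
  rowval (row_mx (- delta_mx 0 j) 0) z = - usubmx z j 0.
Proof.
rewrite rowval_row_mx [X in _ + X]rowvalE big1 ?addr0 => [|i _].
  by rewrite /rowval mulNmx -rowE !mxE.
by rewrite mxE mul0r.
Qed.

Lemma ineqPE (R : realType) (m n : nat) (A : 'M[R]_(m, n)) k z :
  ineqP A k z = rowval (gradP A k) z.
Proof.
case: k => [i|j] /=; last by rewrite rowval_delta.
rewrite rowval_row_mx [X in _ = _ + X]rowvalE big_ord1.
by rewrite [const_mx _ _ _]mxE mulN1r.
Qed.

Lemma ineqQ'E (R : realType) (m n : nat) (A : 'M[R]_(m, n)) beta k z :
  ineqQ' A beta k z = rowval (gradQ' A beta k) z.
Proof.
case: k => [i|j] /=; first by rewrite rowval_delta.
rewrite rowval_row_mx [X in _ = _ + X]rowvalE big_ord_recl big_ord1 !mxE /=.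
rewrite mulN1r addrA; congr (_ + _ - _).
  rewrite rowvalE -sumrN; apply: eq_bigr => i _.
  by rewrite !mxE mulNr mulrC.
by congr (z _ _); apply/val_inj.
Qed.

Lemma nondegenerate_gradP (R : realType) (m n : nat) (A : 'M[R]_(m, n)) :
  nondegenerate_ineqs (ineqP A) (polyhedronP A) n ->
  nondegenerate_ineqs (fun k => rowval (gradP A k))
    (cone_slice (gradP A) (mass_row R n 1)) n.
Proof.
have -> : ineqP A = fun k => rowval (gradP A k).
  by apply/funext => k; apply/funext => z; exact: ineqPE.
suff -> : polyhedronP A = cone_slice (gradP A) (mass_row R n 1) by [].
apply/seteqP; split=> z [gz mz]; split.
- by move=> k; rewrite -ineqPE.
- by rewrite rowval_mass.
- by move=> k; rewrite ineqPE.
- by rewrite -rowval_mass.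
Qed.

Lemma nondegenerate_gradQ' (R : realType) (m n : nat) (A : 'M[R]_(m, n)) beta :
  nondegenerate_ineqs (ineqQ' A beta) (polyhedronQ' A beta) m.+1 ->
  nondegenerate_ineqs (fun k => rowval (gradQ' A beta k))
    (cone_slice (gradQ' A beta) (mass_row R m 2)) m.+1.
Proof.
have -> : ineqQ' A beta = fun k => rowval (gradQ' A beta k).
  by apply/funext => k; apply/funext => z; exact: ineqQ'E.
suff -> : polyhedronQ' A beta =
    cone_slice (gradQ' A beta) (mass_row R m 2) by [].
apply/seteqP; split=> z [gz mz]; split.
- by move=> k; rewrite -ineqQ'E.
- by rewrite rowval_mass.
- by move=> k; rewrite ineqQ'E.
- by rewrite -rowval_mass.
Qed.

(** * Equilibria at a fixed value of [alpha^T x] *)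

Definition dot (R : realType) (n : nat) (u v : 'cV[R]_n) : R :=
  \sum_i u i 0 * v i 0.

Definition maximizes (R : realType) (n : nat) (c x : 'cV[R]_n) : Prop :=
  forall x', simplex x' -> dot c x' <= dot c x.

(** For [x] in the simplex, [l *: beta - A^T *m x] lists the payoffs of the second player's pure
    strategies in the game with matrices A and -A + l 1 beta^T. *)
Definition zero_sum_eq (R : realType) (m n : nat) (A : 'M[R]_(m, n))
    (beta : 'cV[R]_n) (l : R) (x : 'cV[R]_m) (y : 'cV[R]_n) : Prop :=
  [/\ simplex x, simplex y, maximizes (A *m y) x &
      maximizes (l *: beta - A^T *m x) y].

Lemma dotBl (R : realType) (n : nat) (u v w : 'cV[R]_n) :
  dot (u - v) w = dot u w - dot v w.
Proof.
by rewrite /dot -sumrB; apply: eq_bigr => i _; rewrite !mxE mulrBl.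
Qed.

Lemma dotDl (R : realType) (n : nat) (u v w : 'cV[R]_n) :
  dot (u + v) w = dot u w + dot v w.
Proof.
by rewrite /dot -big_split; apply: eq_bigr => i _; rewrite !mxE mulrDl.
Qed.

Lemma dotDr (R : realType) (n : nat) (u v w : 'cV[R]_n) :
  dot u (v + w) = dot u v + dot u w.
Proof.
by rewrite /dot -big_split; apply: eq_bigr => i _; rewrite !mxE mulrDr.
Qed.

Lemma dotZl (R : realType) (n : nat) (t : R) (u v : 'cV[R]_n) :
  dot (t *: u) v = t * dot u v.
Proof.
by rewrite /dot mulr_sumr; apply: eq_bigr => i _; rewrite !mxE mulrA.
Qed.

Lemma dotZr (R : realType) (n : nat) (t : R) (u v : 'cV[R]_n) :
  dot u (t *: v) = t * dot u v.
Proof.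
by rewrite /dot mulr_sumr; apply: eq_bigr => i _; rewrite !mxE mulrCA.
Qed.

Lemma dot_trmx (R : realType) (m n : nat) (A : 'M[R]_(m, n)) x y :
  dot (A^T *m x) y = dot (A *m y) x.
Proof.
rewrite /dot (eq_bigr (fun j => \sum_i A i j * x i 0 * y j 0)) => [|j _].
  rewrite exchange_big /=; apply: eq_bigr => i _.
  by rewrite mxE mulr_suml; apply: eq_bigr => j _; rewrite mulrAC.
by rewrite mxE mulr_suml; apply: eq_bigr => i _; rewrite mxE.
Qed.

Lemma payoffE (R : realType) (m n : nat) (A : 'M[R]_(m, n)) x y :
  payoff A x y = dot (A *m y) x.
Proof.
by rewrite /payoff -mulmxA mxE; apply: eq_bigr => i _; rewrite mxE mulrC.
Qed.

Lemma payoff_rank1 (R : realType) (m n : nat) (A : 'M[R]_(m, n)) alpha beta x y :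
  payoff (- A + alpha *m beta^T) x y =
  dot (dot alpha x *: beta - A^T *m x) y.
Proof.
rewrite payoffE mulmxDl mulNmx addrC dotBl dotBl dotZl dot_trmx; congr (_ - _).
have -> : alpha *m beta^T *m y = dot beta y *: alpha.
  rewrite -mulmxA; apply/colP => i; rewrite !mxE big_ord1 mulrC mxE.
  by congr (_ * _); apply: eq_bigr => j _; rewrite mxE.
by rewrite dotZl mulrC.
Qed.

(** The second player's deviations leave [x] fixed and the first player's payoff does not involve
    [alpha], so [alpha] enters only through [dot alpha x]. *)
Lemma nash_zero_sum (R : realType) (m n : nat) (A : 'M[R]_(m, n)) alpha beta x y :
  nash A (- A + alpha *m beta^T) x y <-> zero_sum_eq A beta (dot alpha x) x y.
Proof.
split=> -[sx sy bx bY]; split=> //.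
- by move=> x' /bx; rewrite !payoffE.
- by move=> y' /bY; rewrite !payoff_rank1.
- by move=> x' /bx; rewrite !payoffE.
- by move=> y' /bY; rewrite !payoff_rank1.
Qed.

Lemma simplex_delta (R : realType) (n : nat) (i : 'I_n) :
  simplex (delta_mx i 0 : 'cV[R]_n).
Proof.
split=> [j|]; first by rewrite mxE ler0n.
rewrite (bigD1 i) //= big1 => [|j ji]; first by rewrite mxE !eqxx addr0.
by rewrite mxE (negbTE ji).
Qed.

Lemma dot_delta (R : realType) (n : nat) (c : 'cV[R]_n) i :
  dot c (delta_mx i 0) = c i 0.
Proof.
rewrite /dot (bigD1 i) //= big1 => [|j ji].
  by rewrite mxE !eqxx mulr1 addr0.
by rewrite mxE (negbTE ji) mulr0.
Qed.

(** Complementary slackness: the products are non-negative, and they sum to 0 because the entries of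
    [x] sum to 1. *)
Lemma maximizes_slack (R : realType) (n : nat) (c x : 'cV[R]_n) :
  simplex x -> maximizes c x ->
  forall i, c i 0 <= dot c x /\ x i 0 * (dot c x - c i 0) = 0.
Proof.
move=> [x0 x1] mx i.
have cp j : c j 0 <= dot c x by rewrite -dot_delta; exact/mx/simplex_delta.
split=> //; have : \sum_i x i 0 * (dot c x - c i 0) == 0.
  under eq_bigr do rewrite mulrBr; rewrite sumrB -mulr_suml x1 mul1r subr_eq0.
  by apply/eqP; apply: eq_bigr => j _; rewrite mulrC.
rewrite psumr_eq0 => [/allP/(_ i (mem_index_enum _))/eqP //|j _].
by rewrite mulr_ge0 // subr_ge0.
Qed.

Lemma slack_maximizes (R : realType) (n : nat) (c x : 'cV[R]_n) (p : R) :
  simplex x -> (forall i, c i 0 <= p /\ x i 0 * (p - c i 0) = 0) ->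
  maximizes c x.
Proof.
move=> [x0 x1] pP x' [x'0 x'1]; have -> : dot c x = p.
  rewrite -[p]mul1r -x1 mulr_suml; apply: eq_bigr => i _.
  have [_ /eqP] := pP i; rewrite mulrBr subr_eq0 => /eqP ->.
  by rewrite mulrC.
rewrite -[p]mulr1 -x'1 mulr_sumr; apply: ler_sum => i _.
by apply: ler_wpM2r => //; have [] := pP i.
Qed.

(** Adding the four optimality inequalities gives (l - l') (beta^T y - beta^T y') >= 0. As the two
    sums agree, the left side is minus a square, hence 0. With equal parameters, this is the
    interchangeability of equilibria in a zero-sum game. *)
Lemma zero_sum_exchange (R : realType) (m n : nat) (A : 'M[R]_(m, n)) beta
    (l l' : R) x y x' y' :
  zero_sum_eq A beta l x y -> zero_sum_eq A beta l' x' y' ->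
  l + dot beta y = l' + dot beta y' ->
  [/\ l = l', dot beta y = dot beta y' & zero_sum_eq A beta l x' y].
Proof.
move=> [sx sy bx bY] [sx' sy' bx' bY'] ll.
have h1 := bx _ sx'; have h2 := bx' _ sx.
have h3 := bY _ sy'; have h4 := bY' _ sy.
rewrite !(dotBl, dotZl, dot_trmx) in h3 h4.
have bb : dot beta y = dot beta y'.
  apply/eqP; rewrite -subr_eq0 -sqrf_eq0 eq_le sqr_ge0 andbT.
  have el : l' = l + dot beta y - dot beta y' by rewrite ll addrK.
  rewrite el in h4; nra.
have {}ll : l = l' by move: ll; rewrite bb => /addIr.
(* Now the four inequalities form a closed chain between the values of x^T A y at the four pairs of
   strategies, so all of these values are equal. *)
rewrite -ll -bb in h3 h4.
split=> //; split=> // [z /bx|z sz]; first by move/le_trans; apply; lra.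
have := bY' _ sz; rewrite !(dotBl, dotZl, dot_trmx) -ll -bb => /le_trans; apply.
lra.
Qed.

(** * Uniqueness: equilibrium strategies as multipliers *)

Lemma rowval_gradP (R : realType) (m n : nat) (A : 'M[R]_(m, n))
    (w : 'cV[R]_(n + 1)) :
  forall k, rowval (gradP A k) w =
  match k with
  | inl i => (A *m usubmx w) i 0 - dsubmx w 0 0
  | inr j => - usubmx w j 0
  end.
Proof.
move=> k; rewrite -ineqPE; case: k => //= i; congr (_ - _).
by rewrite -row_mul mxE.
Qed.

Lemma rowval_gradQ' (R : realType) (m n : nat) (A : 'M[R]_(m, n)) beta
    (w : 'cV[R]_(m + 2)) :
  forall k, rowval (gradQ' A beta k) w =
  match k with
  | inl i => - usubmx w i 0
  | inr j => dsubmx w ord0 0 * beta j 0 - (A^T *m usubmx w) j 0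
             - dsubmx w ord_max 0
  end.
Proof.
move=> k; rewrite -ineqQ'E; case: k => //= j; congr (_ - _).
rewrite addrC mulrC; congr (_ - _).
by rewrite !mxE; apply: eq_bigr => i _; rewrite [RHS]mulrC !mxE.
Qed.

(** At the point (y, p) of P, with p the first player's equilibrium payoff, the entries of [x] and
    the second player's payoff losses are multipliers. On directions of total mass 0 they represent
    the form l beta^T w - pi_1, which does not depend on [x]. *)
Lemma zero_sum_unique_x (R : realType) (m n : nat) (A : 'M[R]_(m, n)) beta
    l x x' y :
  nondegenerate_ineqs (ineqP A) (polyhedronP A) n ->
  zero_sum_eq A beta l x y -> zero_sum_eq A beta l x' y -> x = x'.
Proof.
move=> /nondegenerate_gradP nd [sx sy bx bY] [sx' _ bx' bY'].
have pP := maximizes_slack sx bx; have p'P := maximizes_slack sx' bx'.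
have qP := maximizes_slack sy bY; have q'P := maximizes_slack sy bY'.
have pp' : dot (A *m y) x' = dot (A *m y) x.
  by apply/eqP; rewrite eq_le bx // bx'.
(* Both [x] and [x'] attain the maximum against [y], so one value [p] of the coordinate pi_1 serves
   for both. *)
rewrite {}pp' in p'P; move: (dot _ x) pP p'P => p pP p'P.
pose z : 'cV[R]_(n + 1) := col_mx y (const_mx p).
have zu : usubmx z = y by rewrite col_mxKu.
have zd : dsubmx z 0 0 = p by rewrite col_mxKd mxE.
have Xz : cone_slice (gradP A) (mass_row R n 1) z.
  split; last by rewrite rowval_mass zu; case: sy.
  case=> [i|j]; rewrite rowval_gradP zu ?zd.
    by rewrite subr_le0; have [] := pP i.
  by rewrite oppr_le0; case: sy.
pose mu (u : 'cV[R]_m) (r : R) (k : 'I_m + 'I_n) := match k with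
  | inl i => u i 0
  | inr j => r - (l *: beta - A^T *m u) j 0
  end : R.
have muE u r w : simplex u -> rowval (mass_row R n 1) w = 0 ->
    \sum_k mu u r k * rowval (gradP A k) w
    = l * dot beta (usubmx w) - dsubmx w 0 0.
  move=> [_ u1] mw; rewrite big_sumType /=.
  under eq_bigr do rewrite rowval_gradP mulrBr.
  rewrite sumrB -mulr_suml u1 mul1r addrAC.
  under [X in _ + X - _]eq_bigr do rewrite rowval_gradP mulrN mulrBl opprB.
  rewrite sumrB -mulr_sumr -rowval_mass mw mulr0 subr0.
  rewrite -/(dot (l *: beta - A^T *m u) _) dotBl dotZl.
  rewrite dot_trmx [X in X + _ - _](_ : _ = dot (A *m usubmx w) u) ?subrKC //.
  by apply: eq_bigr => i _; exact: mulrC.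
have comp (u : 'cV[R]_m) r : (forall i, (A *m y) i 0 <= p /\
      u i 0 * (p - (A *m y) i 0) = 0) ->
    (forall j, (l *: beta - A^T *m u) j 0 <= r /\
      y j 0 * (r - (l *: beta - A^T *m u) j 0) = 0) ->
    forall k, mu u r k * rowval (gradP A k) z = 0.
  move=> uP rP [i|j]; rewrite rowval_gradP zu ?zd /mu.
    by rewrite -opprB mulrN; have [_ ->] := uP i; rewrite oppr0.
  by rewrite mulrN mulrC; have [_ ->] := rP j; rewrite oppr0.
have := multipliers_unique (addn1 n) nd Xz (comp _ _ pP qP) (comp _ _ p'P q'P).
move=> uniq; apply/colP => i; apply: (uniq _ (inl i)) => w mw.
by rewrite !muE.
Qed.

(** The same argument at the point (x, l, q) of Q', where the entries of [y] are multipliers. The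
    represented form is now lambda beta^T y - pi_2, which is why equality of [dot beta y] and
    [dot beta y'] is assumed. *)
Lemma zero_sum_unique_y (R : realType) (m n : nat) (A : 'M[R]_(m, n)) beta
    l x y y' :
  nondegenerate_ineqs (ineqQ' A beta) (polyhedronQ' A beta) m.+1 ->
  zero_sum_eq A beta l x y -> zero_sum_eq A beta l x y' ->
  dot beta y = dot beta y' -> y = y'.
Proof.
move=> /nondegenerate_gradQ' nd [sx sy bx bY] [_ sy' bx' bY'] byy'.
have pP := maximizes_slack sx bx; have p'P := maximizes_slack sx bx'.
have qP := maximizes_slack sy bY; have q'P := maximizes_slack sy' bY'.
have qq' : dot (l *: beta - A^T *m x) y' = dot (l *: beta - A^T *m x) y.
  by apply/eqP; rewrite eq_le bY // bY'.
rewrite {}qq' in q'P; move: (dot _ y) qP q'P => q qP q'P.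
pose z : 'cV[R]_(m + 2) :=
  col_mx x (\col_k if k == ord0 then l else q).
have zu : usubmx z = x by rewrite col_mxKu.
have zd0 : dsubmx z ord0 0 = l by rewrite col_mxKd mxE.
have zd1 : dsubmx z ord_max 0 = q by rewrite col_mxKd mxE.
have gz j : rowval (gradQ' A beta (inr j)) z = (l *: beta - A^T *m x) j 0 - q.
  by rewrite rowval_gradQ' zu zd0 zd1 !mxE.
have Xz : cone_slice (gradQ' A beta) (mass_row R m 2) z.
  split; last by rewrite rowval_mass zu; case: sx.
  case=> [i|j]; last by rewrite gz subr_le0; have [] := qP j.
  by rewrite rowval_gradQ' zu oppr_le0; case: sx.
pose mu (u : 'cV[R]_n) (r : R) (k : 'I_m + 'I_n) := match k with
  | inl i => r - (A *m u) i 0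
  | inr j => u j 0
  end : R.
have muE u r w : simplex u -> rowval (mass_row R m 2) w = 0 ->
    \sum_k mu u r k * rowval (gradQ' A beta k) w
    = dsubmx w ord0 0 * dot beta u - dsubmx w ord_max 0.
  move=> [_ u1] mw; rewrite big_sumType /=.
  under eq_bigr do rewrite rowval_gradQ' mulrN mulrBl opprB.
  rewrite sumrB -mulr_sumr -rowval_mass mw mulr0 subr0.
  rewrite -/(dot (A *m u) _).
  under eq_bigr do rewrite rowval_gradQ' mulrBr mulrBr mulrCA.
  rewrite !sumrB -mulr_suml u1 mul1r -mulr_sumr addrA; congr (_ - _).
  rewrite -dot_trmx [X in _ + (_ - X)](_ : _ = dot (A^T *m usubmx w) u).
    by rewrite subrKC; congr (_ * _); apply: eq_bigr => j _; exact: mulrC.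
  by apply: eq_bigr => j _; exact: mulrC.
have comp (u : 'cV[R]_n) r : (forall i, (A *m u) i 0 <= r /\
      x i 0 * (r - (A *m u) i 0) = 0) ->
    (forall j, (l *: beta - A^T *m x) j 0 <= q /\
      u j 0 * (q - (l *: beta - A^T *m x) j 0) = 0) ->
    forall k, mu u r k * rowval (gradQ' A beta k) z = 0.
  move=> uP rP [i|j]; last first.
    by rewrite gz /mu -opprB mulrN; have [_ ->] := rP j; rewrite oppr0.
  rewrite rowval_gradQ' zu /mu.
  by rewrite mulrN mulrC; have [_ ->] := uP i; rewrite oppr0.
have := multipliers_unique (addn2 m) nd Xz (comp _ _ pP qP) (comp _ _ p'P q'P).
move=> uniq; apply/colP => j; apply: (uniq _ (inr j)) => w mw.
by rewrite !muE // byy'.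
Qed.

(** * Existence and continuity in the parameter [s] *)

Lemma simplex_le1 (R : realType) (n : nat) (x : 'cV[R]_n) i :
  simplex x -> 0 <= x i 0 <= 1.
Proof.
move=> [x0 x1]; rewrite x0 -x1 (bigD1 i) //= lerDl.
by apply: sumr_ge0 => j _.
Qed.

Lemma dot_simplex_le (R : realType) (n : nat) (c x : 'cV[R]_n) :
  simplex x -> `|dot c x| <= \sum_i `|c i 0|.
Proof.
move=> sx; apply: (le_trans (ler_norm_sum _ _ _)); apply: ler_sum => i _.
rewrite normrM; have /andP[x0 x1] := simplex_le1 i sx.
by rewrite ler_piMr // ger0_norm.
Qed.

Lemma closed_fun_le0 (R : realType) (T : topologicalType) (f : T -> R) :
  continuous f -> closed [set p | f p <= 0].
Proof.
move=> cf; have -> : [set p | f p <= 0] = f @^-1` [set r | r <= 0] by [].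
by apply: preimage_closed => [p _|]; [exact: cf | exact: closed_le].
Qed.

Lemma closed_fun_eq (R : realType) (T : topologicalType) (f : T -> R) (r : R) :
  continuous f -> closed [set p | f p = r].
Proof.
move=> cf; have -> : [set p | f p = r] = f @^-1` [set r] by [].
by apply: preimage_closed => [p _|]; [exact: cf | exact: closed_eq].
Qed.

Lemma closed_forall (T : topologicalType) (J : Type) (P : J -> Prop)
    (Q : J -> T -> Prop) :
  (forall j, P j -> closed [set p | Q j p]) ->
  closed [set p | forall j, P j -> Q j p].
Proof.
move=> cQ; have -> : [set p | forall j, P j -> Q j p] =
    \bigcap_(j in [set j | P j]) [set p | Q j p] by [].
exact: closed_bigI.
Qed.

Lemma cone_slice_closed (R : realType) (N : nat) (I : finType)
    (a : I -> 'rV[R]_N) (e : 'rV[R]_N) : closed (cone_slice a e).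
Proof.
apply: closedI; last exact/closed_fun_eq/rowval_continuous.
have -> : (fun z => forall k, rowval (a k) z <= 0) =
    [set z | forall k, True -> rowval (a k) z <= 0].
  by apply/seteqP; split=> z /= az k; [move=> _|]; exact: az.
by apply: closed_forall => k _; exact/closed_fun_le0/rowval_continuous.
Qed.

Lemma dot_continuous (R : realType) (n : nat) (T : topologicalType)
    (u v : T -> 'cV[R]_n) :
  (forall i, continuous (fun p => u p i 0)) ->
  (forall i, continuous (fun p => v p i 0)) ->
  continuous (fun p => dot (u p) (v p)).
Proof.
by move=> cu cv; apply: sum_continuous => i; exact: mul_continuous_fun.
Qed.

Lemma mulmx_continuous (R : realType) (m n : nat) (T : topologicalType)
    (A : 'M[R]_(m, n)) (u : T -> 'cV[R]_n) :
  (forall i, continuous (fun p => u p i 0)) ->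
  forall i, continuous (fun p => (A *m u p) i 0).
Proof.
move=> cu i; under eq_fun do rewrite mxE.
apply: sum_continuous => j.
by apply: mul_continuous_fun; first exact: cst_continuous.
Qed.

Lemma simplex_closed (R : realType) (n : nat) (T : topologicalType)
    (u : T -> 'cV[R]_n) :
  (forall i, continuous (fun p => u p i 0)) -> closed [set p | simplex (u p)].
Proof.
move=> cu; apply: closedI; last by apply: closed_fun_eq; exact: sum_continuous.
have -> : (fun p => forall i, 0 <= u p i 0) =
    [set p | forall i, True -> - u p i 0 <= 0].
  by apply/seteqP; split=> p /= up i; have := up i; rewrite oppr_le0 //; apply.
by apply: closed_forall => k _; exact/closed_fun_le0/opp_continuous_fun.
Qed.

Lemma maximizes_closed (R : realType) (n : nat) (T : topologicalType)
    (c u : T -> 'cV[R]_n) :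
  (forall i, continuous (fun p => c p i 0)) ->
  (forall i, continuous (fun p => u p i 0)) ->
  closed [set p | maximizes (c p) (u p)].
Proof.
move=> cc cu.
have -> : [set p | maximizes (c p) (u p)] =
    [set p | forall x', simplex x' -> dot (c p) x' - dot (c p) (u p) <= 0].
  by apply/seteqP; split=> p /= mp x' /mp; rewrite subr_le0.
apply: closed_forall => x' _; apply/closed_fun_le0/add_continuous_fun.
  by apply: dot_continuous => // i; exact: cst_continuous.
exact/opp_continuous_fun/dot_continuous.
Qed.

Lemma zero_sum_closed (R : realType) (m n : nat) (A : 'M[R]_(m, n)) beta
    (T : topologicalType) (l : T -> R) (x : T -> 'cV[R]_m) (y : T -> 'cV[R]_n) :
  continuous l -> (forall i, continuous (fun p => x p i 0)) ->
  (forall j, continuous (fun p => y p j 0)) ->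
  closed [set p | zero_sum_eq A beta (l p) (x p) (y p)].
Proof.
move=> cl cx cy.
have -> : [set p | zero_sum_eq A beta (l p) (x p) (y p)] =
    [set p | simplex (x p)] `&` [set p | simplex (y p)] `&`
    [set p | maximizes (A *m y p) (x p)] `&`
    [set p | maximizes (l p *: beta - A^T *m x p) (y p)].
  by apply/seteqP; split=> p /= => [[]|[[[]]]].
apply: closedI; [apply: closedI; [apply: closedI|]|].
- exact: simplex_closed cx.
- exact: simplex_closed cy.
- exact: maximizes_closed (mulmx_continuous cy) cx.
apply: (maximizes_closed (c := fun p => l p *: beta - A^T *m x p) _ cy) => j.
have -> : (fun p => (l p *: beta - A^T *m x p) j 0) =
    (fun p => l p * beta j 0 - (A^T *m x p) j 0).
  by apply/funext => p; rewrite !mxE.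
apply: add_continuous_fun; last exact/opp_continuous_fun/mulmx_continuous.
by apply: mul_continuous_fun => //; exact: cst_continuous.
Qed.

Lemma simplex_compact (R : realType) (n : nat) :
  compact (@simplex R n).
Proof.
apply: (subclosed_compact _ (@cV_box_compact R n 1)).
  by apply: (@simplex_closed R n _ id) => i; exact: coord_continuous.
move=> x sx i; have /andP[x0 x1] := simplex_le1 i sx.
by rewrite ger0_norm.
Qed.

(** If t differs from h s, then (s, t) has a neighbourhood that avoids [G]. Compactness of [K] gives
    one neighbourhood of s on which no point of [K] outside [U] lies on the graph. *)
Lemma closed_graph_continuous (S T : topologicalType) (K : set T) (h : S -> T)
    (G : set (S * T)) :
  compact K -> closed G -> (forall s, K (h s)) -> (forall s, G (s, h s)) ->
  (forall s t, G (s, t) -> t = h s) -> continuous h.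
Proof.
move=> cK cG Kh Gh uniqh s U Uhs.
have cov : forall t, K t -> \forall t' \near t & s' \near s, G (s', t') -> U t'.
  move=> t _; have [Gst|nGst] := pselect (G (s, t)).
    rewrite (uniqh _ _ Gst); exists (U, setT) => /=.
      by split => //; exact: filterT.
    by move=> [t' s'] /= [].
  have : nbhs (s, t) (~` G).
    by apply: open_nbhs_nbhs; split => //; exact: closed_openC.
  move=> [[V W] /= [sV tW] VW]; exists (W, V) => //= -[t' s'] /= [Wt Vs] Gst.
  by have := VW (s', t') (conj Vs Wt).
have near_sub := (compact_near_coveringP K).1 cK S (nbhs s)
  (fun s' t' => G (s', t') -> U t') (nbhs_filter s) cov.
suff : nbhs s (h @^-1` U) by [].
by apply: filterS near_sub => s' KU; exact: KU.
Qed.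

(** The quadratic term makes the gradient of [obj] in y equal to -(s - beta^T y) beta, so the
    first-order condition will carry the parameter l = s - beta^T y. A minimum exists because
    sublevel sets are compact: pi_1 is bounded below by the payoffs A_i y and above by the
    objective. *)
Lemma polyhedronP_min (R : realType) (m n : nat) (A : 'M[R]_(m, n))
    (beta : 'cV[R]_n) (s : R) : (0 < m)%N -> (0 < n)%N ->
  let obj (z : 'cV[R]_(n + 1)) := dsubmx z 0 0 - s * dot beta (usubmx z)
    + dot beta (usubmx z) ^+ 2 / 2 in
  exists2 z, cone_slice (gradP A) (mass_row R n 1) z &
    forall z', cone_slice (gradP A) (mass_row R n 1) z' -> obj z <= obj z'.
Proof.
move=> m0 n0 obj; pose X := cone_slice (gradP A) (mass_row R n 1).
pose C := \sum_i \sum_j `|A i j|.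
have AC y i : simplex y -> `|(A *m y) i 0| <= C.
  move=> sy; have -> : (A *m y) i 0 = dot (row i A)^T y.
    by rewrite mxE; apply: eq_bigr => j _; rewrite !mxE.
  apply: (le_trans (dot_simplex_le _ sy)).
  rewrite /C (bigD1 i) //=; under eq_bigr do rewrite !mxE.
  by rewrite lerDl; do 2!apply: sumr_ge0 => ? _.
have XP z : X z <->
    simplex (usubmx z) /\ forall i, (A *m usubmx z) i 0 <= dsubmx z 0 0.
  split=> [[az mz]|[[y0 y1] Az]].
    split; first split.
    - by move=> j; have := az (inr j); rewrite rowval_gradP oppr_le0.
    - by rewrite -rowval_mass.
    - by move=> i; have := az (inl i); rewrite rowval_gradP subr_le0.
  split; last by rewrite rowval_mass.
  by case=> k; rewrite rowval_gradP ?subr_le0 ?oppr_le0.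
(* A feasible point: [C] bounds every entry of [A *m y] for [y] in the simplex. *)
pose z0 : 'cV[R]_(n + 1) := col_mx (delta_mx (Ordinal n0) 0) (const_mx C).
have Xz0 : X z0.
  apply/XP; rewrite col_mxKu; have sd := @simplex_delta R n (Ordinal n0).
  split=> // i; rewrite col_mxKd [const_mx _ _ _]mxE.
  exact: le_trans (ler_norm _) (AC _ i sd).
have cobj : continuous obj.
  have cy j : continuous (fun z : 'cV[R]_(n + 1) => usubmx z j 0).
    by under eq_fun do rewrite mxE; exact: coord_continuous.
  have cb : continuous (fun z : 'cV[R]_(n + 1) => dot beta (usubmx z)).
    by apply: dot_continuous => // j; exact: cst_continuous.
  apply: add_continuous_fun; last first.
    apply: mul_continuous_fun; last exact: cst_continuous.
    by under eq_fun do rewrite expr2; exact: mul_continuous_fun.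
  apply: add_continuous_fun.
    by under eq_fun do rewrite mxE; exact: coord_continuous.
  apply: opp_continuous_fun; apply: mul_continuous_fun => //; exact: cst_continuous.
pose S := X `&` [set z | obj z - obj z0 <= 0].
have cS : compact S.
  (* The summand 1 bounds the entries of y, [C] bounds pi_1 from below, and the last two terms bound
     it from above. *)
  pose K := 1 + C + `|obj z0| + s ^+ 2.
  have clS : closed S.
    apply: closedI; first exact: cone_slice_closed.
    by apply/closed_fun_le0/add_continuous_fun => //; exact: cst_continuous.
  apply: (subclosed_compact clS (@cV_box_compact R _ K)).
  move=> z [/XP[sy Az] oz] i; have C0 : 0 <= C by do 2!apply: sumr_ge0 => ? _.
  have s0 := sqr_ge0 s; have o0 := ler_norm (obj z0).
  have oN := normr_ge0 (obj z0).
  case: (split_ordP i) => j ->.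
    have -> : z (lshift 1 j) 0 = usubmx z j 0 by rewrite mxE.
    have /andP[y0 y1] := simplex_le1 j sy.
    rewrite ger0_norm //; rewrite /K; lra.
  have -> : z (rshift n j) 0 = dsubmx z 0 0 by rewrite mxE ord1.
  have := AC _ (Ordinal m0) sy; rewrite ler_norml => /andP[lA _].
  have lAz := Az (Ordinal m0).
  rewrite ler_norml; apply/andP; split; first by rewrite /K; lra.
  (* This square bounds s beta^T y - (beta^T y)^2 / 2 by s^2 / 2, hence pi_1 by
     [obj z0 + s ^+ 2 / 2]. *)
  have := sqr_ge0 (s - dot beta (usubmx z)).
  move: oz; rewrite /= {1}/obj /K; nra.
have [z zS zmin] : exists2 z, z \in S & forall t, t \in S -> obj z <= obj t.
  apply: compact_EVT_min => //; first by exists z0; split => //=; rewrite subrr.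
  exact: continuous_subspaceT.
have [Xz oz] : S z by move: zS; rewrite inE.
exists z => // z' Xz'; have [le0|/ltW] := leP (obj z') (obj z0).
  by apply: zmin; rewrite inE; split => //=; rewrite subr_le0.
by apply: le_trans; rewrite /= subr_le0 in oz.
Qed.

(** The minimiser over P supplies [y]. Its multipliers for the row constraints form [x], those for
    the constraints y_j >= 0 are the second player's payoff losses, and [- kappa] is that player's
    equilibrium payoff. *)
Lemma zero_sum_exists (R : realType) (m n : nat) (A : 'M[R]_(m, n))
    (beta : 'cV[R]_n) (s : R) : (0 < m)%N -> (0 < n)%N ->
  nondegenerate_ineqs (ineqP A) (polyhedronP A) n ->
  exists x y, zero_sum_eq A beta (s - dot beta y) x y.
Proof.
move=> m0 n0 /nondegenerate_gradP nd.
have [z Xz zmin] := polyhedronP_min A beta s m0 n0.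
pose l := s - dot beta (usubmx z).
(* [c] is the gradient of the objective at [z]. *)
pose c : 'rV[R]_(n + 1) := row_mx (- l *: beta^T) (const_mx 1).
have cE w : rowval c w = dsubmx w 0 0 - l * dot beta (usubmx w).
  rewrite rowval_row_mx addrC; congr (_ + _).
    by rewrite rowvalE big_ord1 mxE mul1r.
  rewrite rowvalE /dot mulr_sumr -sumrN; apply: eq_bigr => j _.
  by rewrite !mxE -mulrA mulNr.
have cmin w : rowval (mass_row R n 1) w = 0 ->
    (forall k, rowval (gradP A k) z = 0 -> rowval (gradP A k) w <= 0) ->
    0 <= rowval c w.
  move=> mw aw; have [eps e0 eP] := feasible_direction Xz mw aw.
  pose q := dot beta (usubmx w).
  (* The objective is quadratic, so this product is exactly its increase from [z] to
     [z + t *: w]. *)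
  have step t : 0 <= t <= eps -> 0 <= t * (rowval c w + t * q ^+ 2 / 2).
    have dD : dsubmx (z + t *: w) 0 0 = dsubmx z 0 0 + t * dsubmx w 0 0.
      by rewrite !mxE.
    have uD : usubmx (z + t *: w) = usubmx z + t *: usubmx w.
      by rewrite linearD linearZ.
    by move=> /eP/zmin; rewrite dD uD dotDr dotZr cE -/q /l; nra.
  rewrite leNgt; apply/negP => c0.
  (* If [rowval c w] were negative, this [t] would be feasible and satisfy t q^2 < - c w, so the
     increase would be negative. The added 1 keeps the denominator positive. *)
  pose t := Num.min eps (- rowval c w / (q ^+ 2 + 1)).
  have q0 := sqr_ge0 q; have q1 : 0 < q ^+ 2 + 1 by lra.
  have t0 : 0 < t by rewrite lt_min e0 divr_gt0 // oppr_gt0.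
  have := step t; rewrite ltW // ge_min lexx /= => /(_ isT).
  rewrite pmulr_rge0 // => h.
  have : t * (q ^+ 2 + 1) <= - rowval c w.
    by rewrite -ler_pdivlMr // ge_min lexx orbT.
  nra.
have [mu [kappa [mu0 mus cmu]]] := multipliers_exist (addn1 n) nd Xz cmin.
have [az mz] := Xz.
have sy : simplex (usubmx z).
  split=> [j|]; last by rewrite -rowval_mass.
  by have := az (inr j); rewrite rowval_gradP oppr_le0.
pose x := \col_i mu (inl i).
have cmuE (w : 'cV[R]_(n + 1)) : dsubmx w 0 0 - l * dot beta (usubmx w) =
    kappa * (\sum_j usubmx w j 0) - (dot (A *m usubmx w) x
      - (\sum_i x i 0) * dsubmx w 0 0 - \sum_j mu (inr j) * usubmx w j 0).
  rewrite -cE cmu rowval_mass big_sumType; congr (_ - (_ + _)).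
    rewrite /dot mulr_suml -sumrB; apply: eq_bigr => i _.
    by rewrite rowval_gradP !mxE mulrBr; congr (_ - _); exact: mulrC.
  by rewrite -sumrN; apply: eq_bigr => j _; rewrite rowval_gradP mulrN.
have sx : simplex x.
  split=> [i|]; first by rewrite mxE.
  (* Testing the identity on the pi_1 direction gives total mass 1 for [x]. *)
  have := cmuE (col_mx 0 (const_mx 1)).
  rewrite col_mxKu col_mxKd mulmx0 [const_mx _ _ _]mxE.
  have -> : dot 0 x = 0 by rewrite -(scale0r 0) dotZl mul0r.
  have -> : dot beta 0 = 0 by rewrite -(scale0r 0) dotZr mul0r.
  rewrite [X in kappa * X]big1 => [|j _]; last by rewrite mxE.
  rewrite [X in _ - (_ - X)]big1 => [|j _]; last by rewrite mxE mulr0.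
  lra.
have dualE j : (l *: beta - A^T *m x) j 0 = - kappa - mu (inr j).
  (* Testing on the j-th direction of y expresses the second player's payoff from j as [- kappa]
     minus a non-negative multiplier. *)
  have := cmuE (col_mx (delta_mx j 0) 0).
  have [_ d1] := @simplex_delta R n j.
  rewrite col_mxKu col_mxKd d1 -dot_trmx !dot_delta.
  rewrite (_ : (0 : 'cV[R]_1) 0 0 = 0); last by rewrite mxE.
  rewrite (_ : \sum_i mu (inr i) * _ = mu (inr j)); last first.
    rewrite (bigD1 j) //= big1 ?addr0; first by rewrite mxE !eqxx mulr1.
    by move=> i ij; rewrite mxE (negbTE ij) mulr0.
  by move=> h; rewrite 3!mxE; lra.
exists x, (usubmx z); split => //.
  apply: (slack_maximizes (p := dsubmx z 0 0)) => // i.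
  have := az (inl i); have := mus (inl i); rewrite rowval_gradP.
  rewrite subr_le0 [x i 0]mxE -opprB mulrN => /eqP.
  by rewrite oppr_eq0 => /eqP.
apply: (slack_maximizes (p := - kappa)) => // j; rewrite dualE.
have := mus (inr j); rewrite rowval_gradP => muj; have := mu0 (inr j).
by split; lra.
Qed.

(** * The homeomorphism *)

Lemma entry_continuous (R : realType) (m n : nat) (T : topologicalType)
    (u : T -> 'M[R]_(m, n)) i j :
  continuous u -> continuous (fun p => u p i j).
Proof.
move=> cu p.
apply: (@continuous_comp _ _ _ u (fun M => M i j) p (cu p)).
exact: coord_continuous.
Qed.

Lemma pair_continuous (T U V : topologicalType) (f : T -> U) (g : T -> V) :
  continuous f -> continuous g -> continuous (fun p => (f p, g p)).
Proof. by move=> cf cg p; apply: cvg_pair; [exact: cf | exact: cg]. Qed.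

Lemma fst_continuous_fun (T U V : topologicalType) (f : T -> U * V) :
  continuous f -> continuous (fun p => (f p).1).
Proof.
by move=> cf p; apply: (@continuous_comp _ _ _ f fst p (cf p)); exact: cvg_fst.
Qed.

Lemma snd_continuous_fun (T U V : topologicalType) (f : T -> U * V) :
  continuous f -> continuous (fun p => (f p).2).
Proof.
by move=> cf p; apply: (@continuous_comp _ _ _ f snd p (cf p)); exact: cvg_snd.
Qed.

Lemma id_continuous_fun (T : topologicalType) : continuous (fun p : T => p).
Proof. by move=> p. Qed.

(** Existence gives [h] by choice, and uniqueness makes its graph the closed set [G]; compactness of
    the simplices then gives continuity. *)
Lemma zero_sum_parametrization (R : realType) (m n : nat) (A : 'M[R]_(m, n))
    (beta : 'cV[R]_n) : (0 < m)%N -> (0 < n)%N ->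
  nondegenerate_ineqs (ineqP A) (polyhedronP A) n ->
  nondegenerate_ineqs (ineqQ' A beta) (polyhedronQ' A beta) m.+1 ->
  exists h : R -> 'cV[R]_m * 'cV[R]_n,
    [/\ continuous h,
        forall s, zero_sum_eq A beta (s - dot beta (h s).2) (h s).1 (h s).2 &
        forall l x y, zero_sum_eq A beta l x y -> h (l + dot beta y) = (x, y)].
Proof.
move=> m0 n0 ndP ndQ'.
have /choice[h hP] : forall s, exists p : 'cV[R]_m * 'cV[R]_n,
    zero_sum_eq A beta (s - dot beta p.2) p.1 p.2.
  by move=> s; have [x [y xy]] := zero_sum_exists beta s m0 n0 ndP; exists (x, y).
have hU l x y : zero_sum_eq A beta l x y -> h (l + dot beta y) = (x, y).
  move=> xy; have xy' := hP (l + dot beta y).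
  case: (h _) xy' => x' y' /= xy'.
  (* The mixed pair (x', y) links the two equilibria: it shares [y] with the first, so P yields x =
     x', and it shares [x'] with the second, so Q' yields y = y'. *)
  have [|ll bb x'y] := zero_sum_exchange xy xy'; first by rewrite subrK.
  have xx' := zero_sum_unique_x ndP xy x'y.
  by rewrite -ll in xy'; rewrite xx' -(zero_sum_unique_y ndQ' x'y xy').
exists h; split => //.
pose G := [set p : R * ('cV[R]_m * 'cV[R]_n) |
  zero_sum_eq A beta (p.1 - dot beta p.2.2) p.2.1 p.2.2].
have c0 := @id_continuous_fun (R * ('cV[R]_m * 'cV[R]_n))%type.
have c1 := fst_continuous_fun c0; have c2 := snd_continuous_fun c0.
have cx i := @entry_continuous _ _ _ _ _ i 0 (fst_continuous_fun c2).
have cy j := @entry_continuous _ _ _ _ _ j 0 (snd_continuous_fun c2).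
have closedG : closed G.
  apply: zero_sum_closed => //; apply: add_continuous_fun => //.
  apply: opp_continuous_fun; apply: dot_continuous => // i.
  exact: cst_continuous.
have cK := compact_setX (@simplex_compact R m) (@simplex_compact R n).
apply: (closed_graph_continuous cK closedG) => [s|//|s [x y] /= sxy].
  by have [] := hP s.
by rewrite -(hU _ _ _ sxy) subrK.
Qed.

Lemma dot_const (R : realType) (m : nat) (c : R) (x : 'cV[R]_m) :
  simplex x -> dot (const_mx c) x = c.
Proof.
move=> [_ x1]; rewrite -[RHS]mulr1 -x1 mulr_sumr.
by apply: eq_bigr => i _; rewrite mxE.
Qed.

(** Adding a constant vector to alpha adds the same constant to alpha^T x, since x sums to 1. So
    alpha is determined by its class modulo constant vectors together with alpha^T x, and the free
    constant can encode s instead. *)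
Lemma E_Gamma_parametrization (R : realType) (m n : nat) (A : 'M[R]_(m, n))
    (beta : 'cV[R]_n) : (0 < m)%N -> (0 < n)%N ->
  nondegenerate_ineqs (ineqP A) (polyhedronP A) n ->
  nondegenerate_ineqs (ineqQ' A beta) (polyhedronQ' A beta) m.+1 ->
  exists (F : 'cV[R]_m * 'cV[R]_m * 'cV[R]_n -> 'cV[R]_m)
         (H : 'cV[R]_m -> 'cV[R]_m * 'cV[R]_m * 'cV[R]_n),
    [/\ continuous F, continuous H, forall c, E_Gamma A beta (H c),
        cancel H F & {in E_Gamma A beta, cancel F H}].
Proof.
move=> m0 n0 ndP ndQ'; pose i0 := Ordinal m0.
have [h [ch hP hU]] := zero_sum_parametrization m0 n0 ndP ndQ'.
(* Entry i0 of F p is s, and F p differs from alpha by a constant vector. *)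
pose F (p : 'cV[R]_m * 'cV[R]_m * 'cV[R]_n) :=
  p.1.1 + const_mx (dot p.1.1 p.1.2 + dot beta p.2 - p.1.1 i0 0).
pose l (c : 'cV[R]_m) := c i0 0 - dot beta (h (c i0 0)).2.
(* The shift is the one that makes alpha^T x equal to [l c], as the equilibrium at s = [c i0 0]
   demands. *)
pose al c := c + const_mx (l c - dot c (h (c i0 0)).1).
pose H c := (al c, (h (c i0 0)).1, (h (c i0 0)).2).
have al_l c : dot (al c) (h (c i0 0)).1 = l c.
  by have [sx _ _ _] := hP (c i0 0); rewrite dotDl dot_const // subrKC.
exists F, H; split.
- have c0 := @id_continuous_fun ('cV[R]_m * 'cV[R]_m * 'cV[R]_n)%type.
  have c1 := fst_continuous_fun c0.
  have ca i := @entry_continuous _ _ _ _ _ i 0 (fst_continuous_fun c1).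
  have cx i := @entry_continuous _ _ _ _ _ i 0 (snd_continuous_fun c1).
  have cy i := @entry_continuous _ _ _ _ _ i 0 (snd_continuous_fun c0).
  apply: mx_continuous => i j; rewrite (ord1 j).
  have -> : (fun p => F p i 0) = (fun p =>
      p.1.1 i 0 + (dot p.1.1 p.1.2 + dot beta p.2 - p.1.1 i0 0)).
    by apply/funext => p; rewrite !mxE.
  apply: add_continuous_fun => //.
  apply: add_continuous_fun; last exact: opp_continuous_fun.
  apply: add_continuous_fun; first exact: dot_continuous.
  by apply: dot_continuous => // k; exact: cst_continuous.
- have cc i : continuous (fun c : 'cV[R]_m => c i 0) by exact: coord_continuous.
  have chc : continuous (fun c : 'cV[R]_m => h (c i0 0)).
    by move=> c; apply: continuous_comp; [exact: cc | exact: ch].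
  have cx := fst_continuous_fun chc; have cy := snd_continuous_fun chc.
  apply: pair_continuous => //; apply: pair_continuous => //.
  apply: mx_continuous => i j; rewrite (ord1 j).
  have -> : (fun c => al c i 0) = (fun c : 'cV[R]_m =>
      c i 0 + (c i0 0 - dot beta (h (c i0 0)).2 - dot c (h (c i0 0)).1)).
    by apply/funext => c; rewrite !mxE.
  apply: add_continuous_fun => //; apply: add_continuous_fun.
    apply: add_continuous_fun => //; apply: opp_continuous_fun.
    apply: dot_continuous => k; first exact: cst_continuous.
    exact: entry_continuous.
  apply: opp_continuous_fun; apply: dot_continuous => // k.
  exact: entry_continuous.
- by move=> c; apply/nash_zero_sum; rewrite /= al_l; exact: hP.
- move=> c; rewrite /F /= al_l /l subrK; apply/colP => i.
  rewrite !mxE; ring.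
move=> [[a x] y]; rewrite inE => /nash_zero_sum /= xy.
have [sx _ _ _] := xy.
have Fi0 : F (a, x, y) i0 0 = dot a x + dot beta y by rewrite !mxE /= subrKC.
rewrite /H /al /l Fi0 (hU _ _ _ xy) /= addrK; congr (_, _, _).
apply/colP => i; rewrite dotDl dot_const // !mxE; ring.
Qed.

Theorem theorem18 (R : realType) (m n : nat) (A : 'M[R]_(m, n))
    (beta : 'cV[R]_n) (A_neq0 : A != 0) (beta_neq0 : beta != 0)
    (ndP : nondegenerate_ineqs (ineqP A) (polyhedronP A) n)
    (ndQ' : nondegenerate_ineqs (ineqQ' A beta) (polyhedronQ' A beta) m.+1) :
  homeomorphic (E_Gamma A beta) (Gamma A beta) /\
  homeomorphism [set: 'cV[R]_m] (Gamma A beta) (game A beta).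
Proof.
have m0 : (0 < m)%N.
  by case: m A A_neq0 {ndP ndQ'} => // A; rewrite flatmx0 eqxx.
have [j0 bj0] : exists j, beta j 0 != 0 by apply/cV0Pn.
have n0 : (0 < n)%N := leq_ltn_trans (leq0n _) (ltn_ord j0).
(* The two payoff matrices sum to alpha beta^T, so column [j0] of the sum divided by the non-zero
   entry [beta j0 0] recovers alpha. *)
pose alpha_of (q : 'M[R]_(m, n) * 'M[R]_(m, n)) : 'cV[R]_m :=
  \col_i ((beta j0 0)^-1 * (q.2 i j0 + q.1 i j0)).
have gameK : cancel (game A beta) alpha_of.
  move=> a; apply/colP => i; rewrite !mxE big_ord1 !mxE /=.
  by field.
have cgame : continuous (game A beta).
  apply: pair_continuous; first exact: cst_continuous.
  apply: mx_continuous => i j.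
  have -> : (fun a : 'cV[R]_m => (- A + a *m beta^T) i j) =
      (fun a => - A i j + a i 0 * beta j 0).
    by apply/funext => a; rewrite !mxE big_ord1 !mxE.
  apply: add_continuous_fun; first exact: cst_continuous.
  by apply: mul_continuous_fun; [exact: coord_continuous | exact: cst_continuous].
have calpha : continuous alpha_of.
  have c0 := @id_continuous_fun ('M[R]_(m, n) * 'M[R]_(m, n))%type.
  apply: mx_continuous => i j; rewrite /alpha_of; under eq_fun do rewrite mxE.
  apply: mul_continuous_fun; first exact: cst_continuous.
  apply: add_continuous_fun.
    exact/entry_continuous/snd_continuous_fun.
  exact/entry_continuous/fst_continuous_fun.
split; last first.
  split; [split|exact: continuous_subspaceT|].
  - by move=> a _; exists a.
  - by move=> a a' _ _ /(can_inj gameK).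
  - by move=> _ [a _ <-]; exists a.
  by exists alpha_of; [move=> a _; exact: gameK | exact: continuous_subspaceT].
have [F [H [cF cH HE HK FK]]] := E_Gamma_parametrization m0 n0 ndP ndQ'.
exists (game A beta \o F); split; [split|apply: continuous_subspaceT|].
- by move=> p _; exists (F p).
- by move=> p p' Ep Ep' /(can_inj gameK) /(congr1 H); rewrite !FK.
- by move=> _ [a _ <-]; exists (H a) => //=; rewrite HK.
- by move=> p; apply: continuous_comp; [exact: cF | exact: cgame].
exists (H \o alpha_of).
  by move=> p Ep /=; rewrite gameK FK.
apply: continuous_subspaceT => q.
by apply: continuous_comp; [exact: calpha | exact: cH].
Qed.
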